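(* Let $P\subset\mathbb{R}^d$ be a polytope with vertex set $V(P)$, pyramidal width $\delta>0$ and diameter $D=\sup_{x,y\in P}\|x-y\|$. Let $f:\mathbb{R}^d\to\mathbb{R}$ be differentiable, $\mu$-strongly convex and $L$-smooth, and let $x^\ast$ be the minimizer of $f$ over $P$. Let $\{x_i\}_{i=0}^T\subset P$ be a sequence generated by the Blended Pairwise Conditional Gradients (BPCG) algorithm (described in the context) started at some $x_0\in V(P)$. Then $$f(x_T)-f(x^\ast)\le (f(x_0)-f(x^\ast))\exp(-c_{f,P}\,T),\qquad c_{f,P}:=\frac12\min\left\{\frac12,\ \frac{\mu\delta^2}{4LD^2}\right\}.$$
   Context: $\langle\cdot,\cdot\rangle$ and $\|\cdot\|$ are the Euclidean inner product and norm. A differentiable $f$ is $L$-smooth if $f(y)-f(x)-\langle\nabla f(x),y-x\rangle\le\frac L2\|y-x\|^2$ for all $x,y\in\mathbb{R}^d$, and $\mu$-strongly convex ($\mu>0$) if $f(y)-f(x)-\langle\nabla f(x),y-x\rangle\ge\frac\mu2\|y-x\|^2$ for all $x,y\in\mathbb{R}^d$. Pyramidal width (Lacoste-Julien and Jaggi). For a finite set $A$, a point $x\in\mathrm{conv}(A)$ and $r\neq0$, let $\mathcal S_x$ be the family of subsets $S\subset A$ such that $x$ is a convex combination of the elements of $S$ with all weights strictly positive, and $\mathrm{PdirW}(A,r,x)=\min_{S\in\mathcal S_x}\max_{a\in A,\,s\in S}\langle r/\|r\|,a-s\rangle$. The pyramidal width of $P=\mathrm{conv}(V(P))$ is the infimum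 of $\mathrm{PdirW}(K\cap V(P),r,x)$ over all faces $K$ of $P$, all $x\in K$, and all $r\in\mathrm{cone}(K-x)\setminus\{0\}$. BPCG algorithm. It maintains iterates $x_t\in P$, finite active sets $S_t\subset V(P)$ and an explicit convex combination $x_t=\sum_{v\in S_t}c[x_t](v)\,v$ (nonnegative weights $c[x_t](v)$ summing to $1$). Start: $x_0\in V(P)$, $S_0=\{x_0\}$, $c[x_0](x_0)=1$. For $t=0,1,\dots,T-1$: - choose $a_t\in\mathrm{argmax}_{v\in S_t}\langle\nabla f(x_t),v\rangle$, $s_t\in\mathrm{argmin}_{v\in S_t}\langle\nabla f(x_t),v\rangle$, $w_t\in\mathrm{argmin}_{v\in V(P)}\langle\nabla f(x_t),v\rangle$; - if $\langle\nabla f(x_t),a_t-s_t\rangle\ge\langle\nabla f(x_t),x_t-w_t\rangle$ (pairwise step): set $d_t=a_t-s_t$, $\Lambda_t^\ast=c[x_t](a_t)$, choose $\lambda_t\in\mathrm{argmin}_{\lambda\in[0,\Lambda_t^\ast]}f(x_t-\lambda d_t)$; if $\lambda_t<\Lambda_t^\ast$ set $S_{t+1}=S_t$ (descent step), otherwise set $S_{t+1}=S_t\setminus\{a_t\}$ (drop step); - otherwise (FW step): set $d_t=x_t-w_t$, choose $\lambda_t\in\mathrm{argmin}_{\lambda\in[0,1]}f(x_t-\lambda d_t)$, and set $S_{t+1}=S_t\cup\{w_t\}$ (or $S_{t+1}=\{w_t\}$ if $\lambda_t=1$); - in all cases set $x_{t+1}=x_t-\lambda_t d_t$, with weights updated accordingly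 (pairwise step: move weight $\lambda_t$ from $a_t$ to $s_t$; FW step: multiply all weights by $1-\lambda_t$ and add $\lambda_t$ to the weight of $w_t$). *)

(* Defs.v *)
From HB Require Import structures.
From mathcomp Require Import all_boot all_order finmap all_algebra.
From mathcomp Require Import all_classical all_reals all_analysis.

Set Implicit Arguments.
Unset Strict Implicit.
Unset Printing Implicit Defensive.

Import Order.TTheory GRing.Theory Num.Theory.
Import numFieldNormedType.Exports.

Local Open Scope classical_set_scope.
Local Open Scope ring_scope.

(* The library norm `|x| on 'rV[R]_d is the sup norm, hence [dot] and [enorm].
   The two norms are equivalent, so [differentiable] is not affected. *)
Definition dot (R : realType) (d : nat) (u v : 'rV[R]_d) : R :=
  \sum_(i < d) u 0 i * v 0 i.

Definition enorm (R : realType) (d : nat) (u : 'rV[R]_d) : R :=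
  Num.sqrt (dot u u).

Definition gradient (R : realType) (d : nat) (f : 'rV[R]_d -> R)
    (x : 'rV[R]_d) : 'rV[R]_d :=
  \row_(i < d) 'D_(delta_mx 0 i) f x.

Definition smooth (R : realType) (d : nat) (L : R) (f : 'rV[R]_d -> R) : Prop :=
  forall x y : 'rV[R]_d,
    f y - f x - dot (gradient f x) (y - x) <= L / 2 * enorm (y - x) ^+ 2.

Definition strongly_convex (R : realType) (d : nat) (mu : R)
    (f : 'rV[R]_d -> R) : Prop :=
  0 < mu /\
  forall x y : 'rV[R]_d,
    mu / 2 * enorm (y - x) ^+ 2 <= f y - f x - dot (gradient f x) (y - x).

Definition argmin (R : realType) (T : Type) (A : set T) (g : T -> R) : set T :=
  [set a | A a /\ forall b, A b -> g a <= g b].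

Definition argmax (R : realType) (T : Type) (A : set T) (g : T -> R) : set T :=
  [set a | A a /\ forall b, A b -> g b <= g a].

Definition conv (R : realType) (d : nat) (A : set 'rV[R]_d) : set 'rV[R]_d :=
  [set x | exists (n : nat) (v : 'I_n -> 'rV[R]_d) (c : 'I_n -> R),
     [/\ forall i, A (v i), forall i, 0 <= c i,
         \sum_(i < n) c i = 1 & x = \sum_(i < n) c i *: v i]].

Definition cone (R : realType) (d : nat) (A : set 'rV[R]_d) : set 'rV[R]_d :=
  [set x | exists (n : nat) (v : 'I_n -> 'rV[R]_d) (c : 'I_n -> R),
     [/\ forall i, A (v i), forall i, 0 <= c i &
         x = \sum_(i < n) c i *: v i]].

Definition polytope (R : realType) (d : nat) (P : set 'rV[R]_d) : Prop :=
  exists A : set 'rV[R]_d, finite_set A /\ P = conv A.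

(* P itself is a face (u = 0, b = 0). *)
Definition face (R : realType) (d : nat) (P K : set 'rV[R]_d) : Prop :=
  exists (u : 'rV[R]_d) (b : R),
    (forall x, P x -> dot u x <= b) /\ K = P `&` [set x | dot u x = b].

Definition vertices (R : realType) (d : nat) (P : set 'rV[R]_d) :
    set 'rV[R]_d :=
  [set v | face P [set v]].

Definition diameter (R : realType) (d : nat) (P : set 'rV[R]_d) : R :=
  sup [set enorm (z.1 - z.2) | z in P `*` P].

Definition positive_supports (R : realType) (d : nat) (A : set 'rV[R]_d)
    (x : 'rV[R]_d) : set (set 'rV[R]_d) :=
  [set S | [/\ S `<=` A, finite_set S &
     exists c : 'rV[R]_d -> R,
       [/\ forall s, S s -> 0 < c s, \sum_(s \in S) c s = 1 &
           x = \sum_(s \in S) c s *: s]]].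

(* For finite A the infimum and the supremum below are over finite sets, so
   they are a minimum and a maximum. *)
Definition pdirw (R : realType) (d : nat) (A : set 'rV[R]_d)
    (r x : 'rV[R]_d) : \bar R :=
  ereal_inf [set ereal_sup [set (dot ((enorm r)^-1 *: r) (z.1 - z.2))%:E
                             | z in A `*` S]
              | S in positive_supports A x].

(* For P reduced to a point no direction r is admissible: the width is +oo. *)
Definition pyramidal_width (R : realType) (d : nat) (P : set 'rV[R]_d) :
    \bar R :=
  ereal_inf [set w | exists K x r,
    [/\ face P K, K x, cone [set k - x | k in K] r, r != 0 &
        w = pdirw (K `&` vertices P) r x]].

(* [weight] is total on 'rV[R]_d; vectors outside [active] carry no weight, as set
   up by [bpcg_init] and kept by the updates when a <> s. *)
Record bpcg_state (R : realType) (d : nat) := BPCGState {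
  iterate : 'rV[R]_d;
  active : {fset 'rV[R]_d};
  weight : 'rV[R]_d -> R }.

Definition bpcg_init (R : realType) (d : nat) (x0 : 'rV[R]_d) :
    bpcg_state R d :=
  BPCGState x0 [fset x0]%fset (fun v => (v == x0)%:R).

Definition pairwise_update (R : realType) (d : nat) (X : bpcg_state R d)
    (a s : 'rV[R]_d) (lam : R) : bpcg_state R d :=
  BPCGState
    (iterate X - lam *: (a - s))
    (if lam < weight X a then active X else active X `\ a)%fset
    (fun v => weight X v - lam * (v == a)%:R + lam * (v == s)%:R).

Definition fw_update (R : realType) (d : nat) (X : bpcg_state R d)
    (w : 'rV[R]_d) (lam : R) : bpcg_state R d :=
  BPCGState
    (iterate X - lam *: (iterate X - w))
    (if lam == 1 then [fset w] else w |` active X)%fset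
    (fun v => (1 - lam) * weight X v + lam * (v == w)%:R).

Definition bpcg_step (R : realType) (d : nat) (V : set 'rV[R]_d)
    (f : 'rV[R]_d -> R) (X Y : bpcg_state R d) : Prop :=
  let x := iterate X in
  let g := gradient f x in
  exists a s w : 'rV[R]_d,
    [/\ argmax [set` active X] (dot g) a,
        argmin [set` active X] (dot g) s,
        argmin V (dot g) w &
        if dot g (x - w) <= dot g (a - s) then
          exists2 lam : R,
            argmin [set t | 0 <= t <= weight X a]
                   (fun t => f (x - t *: (a - s))) lam &
            Y = pairwise_update X a s lam
        else
          exists2 lam : R,
            argmin [set t | 0 <= t <= 1]
                   (fun t => f (x - t *: (x - w))) lam &
            Y = fw_update X w lam].

(* [X t] is the state at the beginning of iteration t. *)
Definition bpcg_run (R : realType) (d : nat) (P : set 'rV[R]_d)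
    (f : 'rV[R]_d -> R) (T : nat) (X : nat -> bpcg_state R d) : Prop :=
  (exists2 x0, vertices P x0 & X 0%N = bpcg_init x0) /\
  forall t, (t < T)%N -> bpcg_step (vertices P) f (X t) (X t.+1).

(* Main.v *)
Require Import Defs.
From mathcomp Require Import all_boot all_order finmap all_algebra.
From mathcomp Require Import all_classical all_reals all_analysis.
From mathcomp Require Import ring lra.

Set Implicit Arguments.
Unset Strict Implicit.
Unset Printing Implicit Defensive.

Import Order.TTheory GRing.Theory Num.Theory.
Import numFieldNormedType.Exports.

Local Open Scope classical_set_scope.
Local Open Scope ring_scope.

(** Write h_t for the primal gap f(x_t) - f(xstar), g for the gradient at x_t,
    and G = <g, a - w> for the gap between the away vertex a of the active set
    and the Frank-Wolfe vertex w.  The proof combines three facts.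

    - G is large when h_t is.  The pyramidal width delta satisfies
      delta <g, x - y> <= G |y - x| for every y in P
      ([pyramidal_width_scaling]); with y = xstar, strong convexity then gives
      2 mu delta^2 h_t <= G^2 ([primal_gap_le]).  The scaling inequality is
      where the geometry enters: -g is projected onto the cone of feasible
      directions at x, and the width is applied to the projection p on the face
      of P exposed by -g - p.  That face contains x, the active set, and enough
      of P to generate p, and on it p and -g have the same differences.  The
      projection exists because the cone is finitely generated
      ([cone_projection]).

    - The step direction d chosen by the algorithm satisfies 2 <g, d> >= G, so
      exact line search along d multiplies h_t by at most 1 - rate, where
      rate = min (1/2, mu delta^2 / (4 L D^2)), except when a pairwise step is
      cut short at the weight of a, that is, in a drop step
      ([bpcg_step_progress]).

    - A drop step removes a vertex from the active set, and every other step
      adds at most one.  Hence t + #|S_t| is constant through drop steps and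
      grows by at most 2 in the others, and
      h_t <= h_0 exp (- (rate / 2) (t + #|S_t| - 1)) is an invariant.  As S_T is
      not empty, the bound at t = T is the theorem.

    The weights describe x_t as a positive combination of the active set as long
    as h_t > 0.  Once h_t = 0 this may fail (a pairwise step with a = s may
    remove a vertex that still carries weight), but then the gap stays 0. *)

(** * The Euclidean inner product *)

Section EuclideanSpace.
Context {R : realType} {d : nat}.
Implicit Types (u v w : 'rV[R]_d) (c : R).

Lemma dotC u v : dot u v = dot v u.
Proof. by apply: eq_bigr => i _; rewrite mulrC. Qed.

Lemma dotDl u v w : dot (u + v) w = dot u w + dot v w.
Proof.
by rewrite /dot -big_split; apply: eq_bigr => i _; rewrite mxE mulrDl.
Qed.

Lemma dotZl c u v : dot (c *: u) v = c * dot u v.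
Proof. by rewrite /dot mulr_sumr; apply: eq_bigr => i _; rewrite mxE mulrA. Qed.

Lemma dotNl u v : dot (- u) v = - dot u v.
Proof. by rewrite -scaleN1r dotZl mulN1r. Qed.

Lemma dotBl u v w : dot (u - v) w = dot u w - dot v w.
Proof. by rewrite dotDl dotNl. Qed.

Lemma dot0l u : dot 0 u = 0.
Proof. by rewrite -(scale0r 0) dotZl mul0r. Qed.

Lemma dotDr u v w : dot u (v + w) = dot u v + dot u w.
Proof. by rewrite dotC dotDl !(dotC u). Qed.

Lemma dotZr c u v : dot u (c *: v) = c * dot u v.
Proof. by rewrite dotC dotZl dotC. Qed.

Lemma dotNr u v : dot u (- v) = - dot u v.
Proof. by rewrite dotC dotNl dotC. Qed.

Lemma dotBr u v w : dot u (v - w) = dot u v - dot u w.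
Proof. by rewrite dotDr dotNr. Qed.

Lemma dot0r u : dot u 0 = 0.
Proof. by rewrite dotC dot0l. Qed.

Definition dotE :=
  (dotBl, dotBr, dotDl, dotDr, dotNl, dotNr, dotZl, dotZr, dot0l, dot0r).

Lemma dot_sumr (I : Type) (s : seq I) (Q : pred I) u (F : I -> 'rV[R]_d) :
  dot u (\sum_(i <- s | Q i) F i) = \sum_(i <- s | Q i) dot u (F i).
Proof. by apply: (big_morph (dot u)) => [x y|]; rewrite dotE. Qed.

Lemma dot_ge0 u : 0 <= dot u u.
Proof. by apply: sumr_ge0 => i _; rewrite -expr2 sqr_ge0. Qed.

Lemma dot_eq0 u : dot u u = 0 -> u = 0.
Proof.
move=> /eqP; rewrite psumr_eq0 => [/allP u0|i _]; last by rewrite -expr2 sqr_ge0.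
apply/rowP => i; apply/eqP; have := u0 i (mem_index_enum _).
by rewrite mxE /= mulf_eq0 orbb.
Qed.

Lemma enorm_sqr u : enorm u ^+ 2 = dot u u.
Proof. by rewrite sqr_sqrtr ?dot_ge0. Qed.

Lemma enorm_ge0 u : 0 <= enorm u.
Proof. exact: sqrtr_ge0. Qed.

Lemma enorm_gt0 u : u != 0 -> 0 < enorm u.
Proof.
move=> u0; rewrite sqrtr_gt0 lt_neqAle dot_ge0 andbT eq_sym.
by apply: contra_neq u0; exact: dot_eq0.
Qed.

Lemma CauchySchwarz_dot u v : dot u v <= enorm u * enorm v.
Proof.
have [->|u0] := eqVneq u 0; first by rewrite dot0l mulr_ge0 ?enorm_ge0.
have nu := enorm_gt0 u0.
have [->|v0] := eqVneq v 0; first by rewrite dot0r mulr_ge0 ?enorm_ge0.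
have nv := enorm_gt0 v0.
have := dot_ge0 (enorm v *: u - enorm u *: v).
rewrite !dotE -!enorm_sqr (dotC v u) => h.
have {}h : 0 <= enorm u * enorm v * (enorm u * enorm v - dot u v) by nra.
by move: h; rewrite pmulr_rge0 ?mulr_gt0 // subr_ge0.
Qed.

End EuclideanSpace.

(** * Projection onto a finitely generated cone *)

Section ConeProjection.
Context {R : realType} {d : nat}.

Lemma trmx_mul_eq0 (m n : nat) (B : 'M[R]_(m, n)) :
  (B^T *m B = 0)%R -> B = 0.
Proof.
move=> BB; apply/matrixP => i j; rewrite mxE.
have /eqP := congr1 (fun M : 'M[R]_n => M j j) BB; rewrite !mxE.
under eq_bigr do rewrite mxE -expr2.
rewrite psumr_eq0 => [/allP/(_ i (mem_index_enum _))|k _]; last exact: sqr_ge0.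
by rewrite /= sqrf_eq0 => /eqP.
Qed.

(** The normal equations have a solution because M *m M^T and M^T have the same
    kernel. *)
Lemma gram_solvable (m n : nat) (M : 'M[R]_(m, n)) (r : 'rV[R]_n) :
  exists u : 'rV[R]_m, u *m M *m M^T = r *m M^T.
Proof.
suff /submxP[u ru] : (r *m M^T <= M *m M^T)%MS by exists u; rewrite ru mulmxA.
rewrite submxE -mulmxA; set k := cokermx _.
suff -> : M^T *m k = 0 by rewrite mulmx0.
apply: trmx_mul_eq0; rewrite trmx_mul trmxK -mulmxA [M *m _]mulmxA.
by rewrite mulmx_coker mulmx0.
Qed.

Lemma span_projection (n : nat) (v : 'I_n -> 'rV[R]_d) (r : 'rV[R]_d)
    (I : {set 'I_n}) :
  exists c : 'I_n -> R, (forall i, i \notin I -> c i = 0) /\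
    forall j, j \in I -> dot (r - \sum_i c i *: v i) (v j) = 0.
Proof.
pose M := \matrix_(i < n) (if i \in I then v i else 0).
have [u uM] := gram_solvable M r.
exists (fun i => if i \in I then u 0 i else 0); split=> [i /negbTE -> //|j jI].
have -> : \sum_i (if i \in I then u 0 i else 0) *: v i = u *m M.
  rewrite mulmx_sum_row; apply: eq_bigr => i _; rewrite rowK.
  by case: ifP => _; rewrite ?scale0r ?scaler0.
have /eqP := congr1 (fun x : 'rV[R]_n => x 0 j) uM.
rewrite -subr_eq0 -opprB oppr_eq0 => /eqP.
suff E (y : 'rV[R]_d) : (y *m M^T) 0 j = dot y (v j) by rewrite !E dotBl.
by rewrite mxE; apply: eq_bigr => k _; rewrite !mxE jI.
Qed.

(** Moving from p towards the projection q of r never increases the distance to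
    r; this allows a move towards a span projection to stop early, at the
    boundary of the cone. *)
Lemma span_projection_segment (p q r : 'rV[R]_d) (t : R) :
  dot (r - q) (q - p) = 0 -> 0 <= t <= 1 ->
  enorm (r - (p + t *: (q - p))) ^+ 2 <= enorm (r - p) ^+ 2.
Proof.
move=> orth t01; set e := q - p in orth *.
have -> : r - (p + t *: e) = (r - q) + (1 - t) *: e.
  by apply/rowP => i; rewrite !mxE; ring.
have -> : r - p = (r - q) + e by apply/rowP => i; rewrite !mxE; ring.
rewrite !enorm_sqr [X in X <= _]dotDl [X in _ <= X]dotDl !(dotDr _ (r - q)).
rewrite !dotZl !dotZr !(dotC e (r - q)) orth.
have tt : (1 - t) * (1 - t) <= 1 by nra.
have := ler_wpM2r (dot_ge0 e) tt; lra.
Qed.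


(** The conclusion is the Moreau decomposition of r.  Compactness is avoided:
    the candidates are the span projections C I, one for each set I of
    generators, and among those with nonnegative coefficients there is a closest
    one since there are finitely many.  It beats every cone point c
    ([improve]): move from c towards the span projection on the support of c; if
    this leaves the cone, stop at the boundary, where a coefficient vanishes,
    and repeat with the smaller support.  The inequalities for the generators
    are then the first-order optimality conditions. *)
Lemma cone_projection (n : nat) (v : 'I_n -> 'rV[R]_d) (r : 'rV[R]_d) :
  exists c : 'I_n -> R, let p := \sum_i c i *: v i in
    [/\ forall i, 0 <= c i, dot (r - p) p = 0 &
        forall i, dot (r - p) (v i) <= 0].
Proof.
pose p c := \sum_i c i *: v i.
have [C CI] := choice (span_projection v r).
have C0 (I : {set 'I_n}) i : i \notin I -> C I i = 0 by move: i; case: (CI I).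
have Corth (I : {set 'I_n}) c : (forall i, i \notin I -> c i = 0) ->
    dot (r - p (C I)) (p c) = 0.
  move=> c0; rewrite dot_sumr big1 // => i _; rewrite dotZr.
  have [iI|iI] := boolP (i \in I); last by rewrite c0 // mul0r.
  by case: (CI I) => _ ->; rewrite ?mulr0.
pose q c := enorm (r - p c) ^+ 2.
pose good (I : {set 'I_n}) := [forall i, 0 <= C I i].
pose supp (c : 'I_n -> R) := [set i | (c i != 0)%R]%SET.
have improve (k : nat) (c : 'I_n -> R) :
    (forall i, 0 <= c i) -> (#|supp c| < k)%N ->
    exists2 I, good I & q (C I) <= q c.
  elim: k c => // k IHk c c0; set I := supp c; rewrite ltnS => Ik.
  have cI i : i \notin I -> c i = 0 by rewrite inE negbK => /eqP.
  have orth : dot (r - p (C I)) (p (C I) - p c) = 0.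
    by rewrite dotBr !Corth ?subr0 // => i /C0.
  have qle t : 0 <= t <= 1 ->
      enorm (r - (p c + t *: (p (C I) - p c))) ^+ 2 <= q c.
    exact: span_projection_segment.
  have [gI|] := boolP (good I).
    exists I => //; have := qle 1; rewrite scale1r [p c + _]addrC subrK; apply.
    by rewrite ler01 lexx.
  move=> /forallPn[i0]; rewrite -ltNge => i0lt.
  pose ratio i := c i / (c i - C I i).
  (* j is the coefficient that reaches zero first on the way to C I. *)
  have [j jlt jmin] := @arg_minP _ _ _ i0 (fun i => C I i < 0) ratio i0lt.
  have den i : C I i < 0 -> 0 < c i - C I i.
    by move=> ?; rewrite subr_gt0 (lt_le_trans _ (c0 i)).
  have t0 : 0 <= ratio j by rewrite divr_ge0 // ltW // den.
  have t1 : ratio j <= 1.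
    by rewrite ler_pdivrMr ?den // mul1r lerBrDr gerDl ltW.
  pose c' i := c i + ratio j * (C I i - c i).
  have pc' : p c' = p c + ratio j *: (p (C I) - p c).
    rewrite /p -sumrB scaler_sumr -big_split; apply: eq_bigr => i _ /=.
    by rewrite scalerDl -scalerA scalerBl.
  have c'0 i : 0 <= c' i.
    rewrite /c'; have [Ci|Ci] := ltP (C I i) 0; last first.
      by have := c0 i; nra.
    have := jmin i Ci; rewrite {2}/ratio ler_pdivlMr ?den //; lra.
  have jI : j \in I by apply: contraLR jlt => /C0 ->; rewrite ltxx.
  have c'j : c' j = 0.
    by rewrite /c' -opprB mulrN /ratio divfK ?subrr // gt_eqF ?den.
  have suppc' : (supp c' \subset I :\ j)%SET.
    apply/fintype.subsetP => i; rewrite in_setD1 [i \in supp c']inE => c'i.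
    apply/andP; split; first by apply: contraNneq c'i => ->; rewrite c'j.
    by apply: contraNT c'i => iI; rewrite /c' C0 // cI // subrr mulr0 addr0.
  have [|J gJ qJ] := IHk c' c'0.
    apply: leq_ltn_trans (subset_leq_card suppc') _.
    by rewrite (cardsD1 j) jI add1n in Ik.
  exists J => //; apply: le_trans qJ _; rewrite /q pc'.
  by apply: qle; rewrite t0 t1.
have [I0 gI0 _] := improve _ (fun=> 0) (fun=> lexx 0) (leqnn _).
have [I gI Imin] := @arg_minP _ _ _ I0 good (fun I => q (C I)) gI0.
exists (C I); split=> [i||i]; first exact: (forallP gI).
  by apply: Corth => i /C0.
set x := r - p (C I); rewrite leNgt; apply/negP => xv.
have vv : 0 <= dot (v i) (v i) := dot_ge0 _.
(* Moving by t along v i would bring p (C I) closer to r; the + 1 keeps the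
   quotient meaningful when v i = 0. *)
pose t := dot x (v i) / (dot (v i) (v i) + 1).
have t0 : 0 < t by rewrite divr_gt0 // ltr_wpDl.
have tE : t * (dot (v i) (v i) + 1) = dot x (v i).
  by rewrite divfK // gt_eqF // ltr_wpDl.
pose c' k := C I k + t * (k == i)%:R.
have pc' : p c' = p (C I) + t *: v i.
  rewrite /p /c'; under eq_bigr do rewrite scalerDl.
  rewrite big_split; congr (_ + _); rewrite /= (bigD1 i) //= eqxx mulr1.
  rewrite big1 ?addr0 // => k /negbTE ->.
  by rewrite mulr0 scale0r.
have c'0 k : 0 <= c' k.
  by apply: addr_ge0; [exact: (forallP gI)|rewrite mulr_ge0 ?ler0n ?ltW].
have [J gJ qJ] := improve _ c' c'0 (leqnn _).
have {Imin qJ} : enorm x ^+ 2 <= enorm (x - t *: v i) ^+ 2.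
  have := le_trans (Imin J gJ) qJ.
  by rewrite /q pc' opprD addrA.
rewrite !enorm_sqr; move: x xv t t0 tE {c' pc' c'0} => x xv t t0 tE.
rewrite !dotE (dotC (v i) x) -tE.
nra.
Qed.

End ConeProjection.

(** * Polytopes, vertices and pyramidal width *)

Section Polytopes.
Context {R : realType} {d : nat}.
Implicit Types (A P : set 'rV[R]_d) (u v x y g : 'rV[R]_d).

Lemma sub_conv A : A `<=` Defs.conv A.
Proof.
move=> a Aa; exists 1%N, (fun=> a), (fun=> 1); split=> //.
  by rewrite big_ord1.
by rewrite big_ord1 scale1r.
Qed.

Lemma conv_nonempty A x : Defs.conv A x -> exists a, A a.
Proof.
case=> -[|n] [v] [c] [Av _ c1 _]; last by exists (v ord0).
by move: c1; rewrite big_ord0 => /esym/eqP; rewrite oner_eq0.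
Qed.

Lemma conv_dot_le A u b x :
  (forall a, A a -> dot u a <= b) -> Defs.conv A x -> dot u x <= b.
Proof.
move=> ub [n [v [c [Av c0 c1 ->]]]]; rewrite dot_sumr.
rewrite -[b]mul1r -c1 mulr_suml; apply: ler_sum => i _.
by rewrite dotZr ler_wpM2l ?ub.
Qed.

Lemma vertices_sub P : vertices P `<=` P.
Proof.
by move=> v [u [b [_ vE]]]; have : [set v] v by []; rewrite {1}vE => -[].
Qed.

(** The weighted average of the slacks b - <u, v i> vanishes, so each slack that
    has a nonzero weight does. *)
Lemma supporting_combination (I : eqType) (s : seq I) (v : I -> 'rV[R]_d)
    (c : I -> R) u b :
  {in s, forall i, 0 <= c i} -> {in s, forall i, dot u (v i) <= b} ->
  \sum_(i <- s) c i = 1 -> dot u (\sum_(i <- s) c i *: v i) = b ->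
  {in s, forall i, c i != 0 -> dot u (v i) = b}.
Proof.
move=> c0 ub c1 ue i si ci.
have : \sum_(i <- s | i \in s) c i * (b - dot u (v i)) = 0.
  rewrite -big_seq; under eq_bigr do rewrite mulrBr.
  rewrite sumrB -mulr_suml c1 mul1r -ue dot_sumr; apply/eqP.
  by rewrite subr_eq0; apply/eqP/eq_bigr => j _; rewrite dotZr.
move/eqP; rewrite psumr_eq0 => [/allP/(_ _ si)|j js]; last first.
  by rewrite mulr_ge0 ?c0 // subr_ge0 ub.
by rewrite si mulf_eq0 (negbTE ci) /= subr_eq0 => /eqP.
Qed.

Lemma fset_argmax (T : choiceType) (E : {fset T}) (Q : pred T) (F : T -> R)
    (x0 : T) :
  x0 \in E -> Q x0 ->
  exists m, [/\ m \in E, Q m & forall z, z \in E -> Q z -> F z <= F m].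
Proof.
move=> x0E Qx0.
have [i Qi imax] :=
  @arg_maxP _ _ E [` x0E]%fset (fun i => Q (val i)) (fun i => F (val i)) Qx0.
exists (val i); split=> // [|z zE Qz]; first exact: fsvalP.
exact: imax [` zE]%fset Qz.
Qed.

(** Vertices are exposed points, so a minimal face of g is not enough: a
    functional with a unique maximizer is needed.  Among the generators that
    minimize g, the one of largest norm, v, is the only maximizer of <v, .>; the
    functional v - M g with M large then exposes v in P. *)
Lemma vertex_minimizes P g x :
  polytope P -> P x ->
  exists2 v, vertices P v & forall y, P y -> dot g v <= dot g y.
Proof.
move=> [A [/finite_fsetP[E AE] PA]] Px.
have [a0 Aa0] : exists a, A a by apply: (@conv_nonempty _ x); rewrite -PA.
have AEP a : A a <-> a \in E by rewrite AE.
have [m [mE _ mmin]] := fset_argmax (fun a => - dot g a) ((AEP _).1 Aa0)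
  (isT : xpredT a0).
have {}mmin a : a \in E -> dot g m <= dot g a.
  by move=> aE; rewrite -lerN2 mmin.
have [v [vE /eqP gv vmax]] := @fset_argmax _ E (fun a => dot g a == dot g m)
  (fun a => dot a a) m mE (eqxx _).
pose ratio a := dot v (a - v) / (dot g a - dot g m).
pose M := \big[Order.max/0]_(a <- E) ratio a + 1.
pose u := v - M *: g.
have uv a : a \in E -> a != v -> dot u a < dot u v.
  move=> aE av; rewrite -subr_gt0 -dotBr.
  have := mmin a aE; rewrite le_eqVlt => /orP[/eqP ga|ga].
    have := vmax a aE; rewrite ga eqxx => /(_ isT) aav.
    have : dot (v - a) (v - a) != 0.
      by apply: contra_neq av => /dot_eq0/eqP; rewrite subr_eq0 => /eqP.
    have := dot_ge0 (v - a).
    rewrite /u !dotE gv -ga (dotC a v); lra.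
  have : ratio a < M by rewrite ltr_pwDr // le_bigmax_seq.
  rewrite ltr_pdivrMr ?subr_gt0 // /u !dotE gv; lra.
exists v; last first.
  move=> y; rewrite PA -lerN2 -!dotNl => /conv_dot_le; apply=> a /AEP aE.
  by rewrite !dotNl lerN2 gv mmin.
have uvle a : A a -> dot u a <= dot u v.
  by move=> /AEP aE; have [->//|av] := eqVneq a v; rewrite ltW ?uv.
exists u, (dot u v); split; first by move=> z; rewrite PA; exact: conv_dot_le.
apply/seteqP; split=> [z ->|z [/=]].
  by split=> //; rewrite PA; apply/sub_conv/AEP.
rewrite PA => -[n [w [c [Aw c0 c1 zE]]]] uz.
have wv i : c i != 0 -> w i = v.
  move=> ci; have ui : dot u (w i) = dot u v.
    apply: (supporting_combination _ _ c1 _ (mem_index_enum i) ci).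
    - by move=> j _; exact: c0.
    - by move=> j _; exact: uvle.
    - by rewrite -zE.
  apply/eqP/negPn/negP => wiv; have := uv (w i) ((AEP _).1 (Aw i)) wiv.
  by rewrite ui ltxx.
rewrite zE -[v]scale1r -c1 scaler_suml; apply: eq_bigr => i _.
by have [->|/wv ->//] := eqVneq (c i) 0; rewrite !scale0r.
Qed.

Lemma enorm_triangle u v : enorm (u + v) <= enorm u + enorm v.
Proof.
rewrite -(@ler_pXn2r _ 2) ?nnegrE ?addr_ge0 ?enorm_ge0 //.
rewrite sqrrD !enorm_sqr !dotE (dotC v u).
have := CauchySchwarz_dot u v; lra.
Qed.

Lemma enormN u : enorm (- u) = enorm u.
Proof. by rewrite /enorm dotNl dotNr opprK. Qed.

Lemma le_diameter P x y :
  polytope P -> P x -> P y -> enorm (x - y) <= diameter P.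
Proof.
move=> [A [/finite_fsetP[E AE] PA]] Px Py.
pose B := \big[Order.max/0]_(a <- E) enorm a.
have PB z : P z -> enorm z <= B.
  move=> Pz; have [->|z0] := eqVneq z 0.
    by rewrite {1}/enorm dot0l sqrtr0 bigmax_ge_id.
  rewrite -(ler_pM2l (enorm_gt0 z0)) -expr2 enorm_sqr.
  rewrite PA in Pz; apply: conv_dot_le (Pz) => a Aa.
  apply: le_trans (CauchySchwarz_dot _ _) _.
  by rewrite ler_wpM2l ?enorm_ge0 // le_bigmax_seq //; rewrite AE in Aa.
apply: ub_le_sup; last by exists (x, y).
exists (B + B) => _ [[w z] [/= Pw Pz] <-].
by apply: le_trans (enorm_triangle _ _) _; rewrite enormN lerD ?PB.
Qed.

(** The pyramidal width bounds a pairwise gap from below only in directions r of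
    the cone generated by K - x, for a face K.  In general, let p be the
    projection of r onto the cone of P - x and q = r - p.  By the polar
    inequalities x lies on the face K of P exposed by q, hence so does the
    support S of x; and since <q, p> = 0, only points of K occur in the
    expression of p, so that p is in the cone of K - x.  On K the functionals
    p and r have the same differences, which gives delta |p| <= hi - lo.
    Finally <r, y - x> <= <p, y - x> <= |p| |y - x|. *)
Lemma pyramidal_width_scaling P (S : set 'rV[R]_d) (delta hi lo : R) r x y :
  polytope P -> (delta%:E <= pyramidal_width P)%E -> 0 <= delta ->
  P x -> P y -> positive_supports (vertices P) x S ->
  (forall v, vertices P v -> dot r v <= hi) ->
  (forall s, S s -> lo <= dot r s) ->
  delta * dot r (y - x) <= (hi - lo) * enorm (y - x).
Proof.
move=> [A [/finite_fsetP[E AE] PA]] width delta0 Px Py.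
move=> [SV finS [c [c0 c1 xE]]] hiV loS.
have AEP a : A a <-> a \in E by rewrite AE.
pose gen (i : 'I_(size E)) := nth 0 E i - x.
have [k] := cone_projection gen r.
set p := \sum_i _; set q := r - p => -[k0 qp qgen].
have qP z : P z -> dot q z <= dot q x.
  rewrite PA; apply: conv_dot_le => a /AEP aE.
  have aE' : (index a E < size E)%N by rewrite index_mem.
  by have := qgen (Ordinal aE'); rewrite /gen /= nth_index // dotBr subr_le0.
have rp z : P z -> dot r (z - x) <= dot p (z - x).
  by move=> /qP; rewrite /q !dotE; lra.
have VP v : vertices P v -> P v by exact: vertices_sub.
have [s0 Ss0] : S !=set0.
  apply/set0P/eqP => S0; move: c1; rewrite S0 fsbig_set0.
  by move=> /esym/eqP; rewrite oner_eq0.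
have lohi : lo <= hi by apply: le_trans (loS _ Ss0) (hiV _ (SV _ Ss0)).
(* When p = 0, r has no positive component in any feasible direction. *)
have [p0|p0] := eqVneq p 0.
  have := rp y Py; rewrite p0 dot0l => ry.
  apply: (@le_trans _ _ 0); first by rewrite mulr_ge0_le0.
  by rewrite mulr_ge0 ?enorm_ge0 ?subr_ge0.
have np := enorm_gt0 p0.
pose K := P `&` [set z | dot q z = dot q x].
have Kx : K x by [].
have SK : S `<=` K.
  move=> s Ss; split; first exact/VP/SV.
  have sS z : (z \in fset_set S) = (z \in S) by rewrite in_fset_set.
  apply: (@supporting_combination _ (fset_set S) id c); rewrite ?sS ?inE //.
  - by move=> z; rewrite sS inE => /c0/ltW.
  - by move=> z; rewrite sS inE => Sz; exact/qP/VP/SV.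
  - by rewrite -fsbig_finite.
  - by rewrite -fsbig_finite // -xE.
  - by rewrite gt_eqF ?c0.
have Kp : cone [set z - x | z in K] p.
  have kgen i : k i != 0 -> dot q (gen i) = 0.
    move=> ki; have : \sum_i (k i * - dot q (gen i)) = 0.
      under eq_bigr do rewrite mulrN.
      rewrite sumrN; apply/eqP; rewrite oppr_eq0 -[X in _ == X]qp dot_sumr.
      by apply/eqP; apply: eq_bigr => j _; rewrite dotZr.
    move/eqP; rewrite psumr_eq0 => [/allP/(_ i (mem_index_enum _))|j _].
      by rewrite /= mulf_eq0 (negbTE ki) oppr_eq0 => /eqP.
    by rewrite mulr_ge0 ?oppr_ge0.
  (* Generators of zero weight may lie outside K; x itself replaces them. *)
  exists (size E), (fun i => if k i == 0 then 0 else gen i), k; split=> //.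
    move=> i; case: ifPn => [_|/kgen qi]; first by exists x; rewrite ?subrr.
    exists (nth 0 E i) => //; split.
      by rewrite PA; apply/sub_conv/AEP/mem_nth.
    by apply/eqP; rewrite -subr_eq0 -dotBr qi.
  by apply: eq_bigr => i _; case: ifPn => // /eqP ->; rewrite !scale0r.
have faceK : face P K by exists q, (dot q x).
have : (delta%:E <= ((enorm p)^-1 * (hi - lo))%:E)%E.
  apply: le_trans width _.
  apply: (@le_trans _ _ (pdirw (K `&` vertices P) p x)).
    by apply: ereal_inf_lbound; exists K, x, p.
  apply: (@le_trans _ _ (ereal_sup
      [set (dot ((enorm p)^-1 *: p) (z.1 - z.2))%:E
        | z in (K `&` vertices P) `*` S])).
    apply: ereal_inf_lbound; exists S => //; split=> //; last by exists c.
    by move=> s Ss; split; [exact: SK|exact: SV].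
  apply: ge_ereal_sup => _ [[a s] [/= [Ka Va] Ss] <-].
  rewrite lee_fin dotZl ler_wpM2l ?invr_ge0 ?enorm_ge0 //.
  have [_ /= qa] := Ka; have [_ /= qs] := SK s Ss.
  have := loS s Ss; have := hiV a Va; move: qa qs; rewrite /q !dotE; lra.
rewrite lee_fin mulrC ler_pdivlMr // => deltap.
apply: (@le_trans _ _ (delta * (enorm p * enorm (y - x)))).
  rewrite ler_wpM2l //; apply: le_trans (rp _ Py) _.
  exact: CauchySchwarz_dot.
by rewrite mulrA ler_wpM2r ?enorm_ge0.
Qed.

End Polytopes.

(** * Strong convexity, smoothness and line search *)

Section LineSearch.
Context {R : realType} {d : nat}.
Implicit Types (f : 'rV[R]_d -> R) (x y : 'rV[R]_d) (L mu t : R).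

Lemma strongly_convex_above_tangent mu f x y :
  strongly_convex mu f -> f x + dot (gradient f x) (y - x) <= f y.
Proof.
move=> [mu0 /(_ x y)]; have : 0 <= mu / 2 * enorm (y - x) ^+ 2.
  by rewrite mulr_ge0 ?sqr_ge0 // divr_ge0 // ltW.
lra.
Qed.

(** With n = |y - x|, strong convexity bounds f x - f y by
    (G / delta) n - (mu / 2) n^2, whose maximum over n is
    G^2 / (2 mu delta^2). *)
Lemma primal_gap_le mu delta G f x y :
  strongly_convex mu f -> 0 < delta ->
  delta * dot (gradient f x) (x - y) <= G * enorm (y - x) ->
  2 * mu * delta ^+ 2 * (f x - f y) <= G ^+ 2.
Proof.
move=> [mu0 /(_ x y)] fxy delta0; rewrite -opprB dotNr.
set n := enorm _ in fxy *; set e := dot _ _ in fxy * => eG.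
apply: (@le_trans _ _ (2 * mu * delta ^+ 2 * (- e - mu / 2 * n ^+ 2))).
  rewrite ler_pM2l ?mulr_gt0 ?exprn_gt0 //; lra.
apply: (@le_trans _ _ (2 * mu * delta * (G * n) - (mu * delta * n) ^+ 2)).
  have : 2 * mu * delta * (delta * - e) <= 2 * mu * delta * (G * n).
    by rewrite ler_pM2l ?mulr_gt0.
  lra.
by have := sqr_ge0 (G - mu * delta * n); lra.
Qed.

Lemma smooth_step L D f x dd t :
  smooth L f -> 0 <= L -> enorm dd <= D ->
  f (x - t *: dd) <= f x - t * dot (gradient f x) dd + L / 2 * t ^+ 2 * D ^+ 2.
Proof.
move=> /(_ x (x - t *: dd)) + L0 ddD.
have -> : x - t *: dd - x = - (t *: dd) by rewrite addrAC subrr add0r.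
rewrite enorm_sqr !dotE -enorm_sqr.
have : L / 2 * t ^+ 2 * enorm dd ^+ 2 <= L / 2 * t ^+ 2 * D ^+ 2.
  apply: ler_wpM2l; first by rewrite mulr_ge0 ?sqr_ge0 // divr_ge0.
  by rewrite lerXn2r // nnegrE ?enorm_ge0 // (le_trans (enorm_ge0 dd)).
lra.
Qed.

(** A minimizer short of the end of the search interval is a minimizer on the
    whole ray, by convexity: at the end point Lam the slope cannot be negative,
    so f does not decrease beyond it.  This is why only drop steps may fail to
    make progress. *)
Lemma segment_argmin_ray mu f x dd (lam Lam t : R) :
  strongly_convex mu f ->
  argmin [set t | 0 <= t <= Lam] (fun t => f (x - t *: dd)) lam ->
  lam < Lam -> 0 <= t -> f (x - lam *: dd) <= f (x - t *: dd).
Proof.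
move=> fconv [/= /andP[lam0 _] lamle] lamLam t0.
have [tLam|Lamt] := leP t Lam; first by apply: lamle; rewrite /= t0 tLam.
have Lamle := lamle Lam; rewrite /= lexx (le_trans lam0 (ltW lamLam)) in Lamle.
apply: (le_trans (Lamle isT)).
pose z := x - Lam *: dd; rewrite -/z.
have := strongly_convex_above_tangent z (x - lam *: dd) fconv.
have -> : x - lam *: dd - z = (Lam - lam) *: dd.
  by apply/rowP => i; rewrite !mxE; ring.
have := strongly_convex_above_tangent z (x - t *: dd) fconv.
have -> : x - t *: dd - z = (Lam - t) *: dd.
  by apply/rowP => i; rewrite !mxE; ring.
have {Lamle} := Lamle isT; rewrite -/z !dotZr; set e := dot _ dd.
move: (f z) (f _) (f _) => fz fl ft h1 h2 h3.
have e0 : e <= 0.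
  have : (Lam - lam) * e <= 0 by lra.
  by rewrite pmulr_rle0 // subr_gt0.
have : 0 <= (Lam - t) * e by rewrite mulr_le0 // subr_le0 ltW.
lra.
Qed.

End LineSearch.

Section Progress.
Context {R : realType}.
(* Q is L D^2, m is mu delta^2, g is the slope <grad f x, d>
   along the step, h is the primal gap, and fx, fy are the values of f before
   and after the step. *)
Variables (Q m g h fx fy : R).
Hypotheses (Q0 : 0 < Q) (g0 : 0 <= g) (h0 : 0 <= h) (mh : m * h <= 2 * g ^+ 2).

Let rate := Num.min (1 / 2) (m / (4 * Q)).

Lemma full_step_progress :
  fy <= fx - g ^+ 2 / (2 * Q) -> fy <= fx - rate * h.
Proof.
move=> fyle; apply: (le_trans fyle); rewrite lerD2l lerN2.
have : rate * h <= m / (4 * Q) * h by rewrite ler_wpM2r // ge_min lexx orbT.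
move=> /le_trans; apply.
rewrite mulrAC ler_pdivrMr ?mulr_gt0 //.
have -> : g ^+ 2 / (2 * Q) * (4 * Q) = 2 * g ^+ 2 by field; rewrite gt_eqF.
exact: mh.
Qed.

Lemma unbounded_search_progress :
  (forall t, 0 <= t -> fy <= fx - t * g + Q / 2 * t ^+ 2) ->
  fy <= fx - rate * h.
Proof.
move=> /(_ (g / Q)) fyle; apply: full_step_progress.
apply: le_trans (fyle _) _; first by rewrite divr_ge0 // ltW.
by rewrite le_eqVlt; apply/orP; left; apply/eqP; field; rewrite gt_eqF.
Qed.

(** The unconstrained minimizer g / Q of the quadratic bound is used when it is
    at most 1, and the full step otherwise; in the second case Q < g, and the
    decrease is at least g / 2 >= h / 2. *)
Lemma unit_search_progress :
  h <= g ->
  (forall t, 0 <= t <= 1 -> fy <= fx - t * g + Q / 2 * t ^+ 2) ->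
  fy <= fx - rate * h.
Proof.
move=> hg fyle; have [gQ|Qg] := leP g Q.
  apply: full_step_progress; apply: le_trans (fyle (g / Q) _) _.
    by rewrite divr_ge0 ?(ltW Q0) //= ler_pdivrMr // mul1r.
  by rewrite le_eqVlt; apply/orP; left; apply/eqP; field; rewrite gt_eqF.
apply: le_trans (fyle 1 _) _; first by rewrite ler01 lexx.
have : rate * h <= 1 / 2 * h by rewrite ler_wpM2r // ge_min lexx.
lra.
Qed.

End Progress.

(** * Weights on the active set *)

Section Weights.
Context {R : realType} {T : choiceType} {W : lmodType R}.
Implicit Types (E : {fset T}) (c : T -> R) (G : T -> W).

(* Sums are taken with values in a module so that each lemma serves both for the
   total weight and for the barycenter. *)
Lemma sum_delta E a G :
  a \in E -> \sum_(v <- E) (v == a)%:R *: G v = G a.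
Proof.
move=> aE; rewrite (bigD1_seq a) //= eqxx scale1r big1 ?addr0 // => v.
by move=> /negbTE ->; rewrite scale0r.
Qed.

Lemma sum_weight_support E E' c G :
  (E `<=` E')%fset -> (forall v, v \in E' -> v \notin E -> c v = 0) ->
  \sum_(v <- E) c v *: G v = \sum_(v <- E') c v *: G v.
Proof.
by move=> EE' c0; apply: big_fset_incl => // v vE' /c0 ->; rewrite ?scale0r.
Qed.

Lemma sum_weight_pairwise E c G a s lam :
  a \in E -> s \in E ->
  \sum_(v <- E) (c v - lam * (v == a)%:R + lam * (v == s)%:R) *: G v =
  \sum_(v <- E) c v *: G v - lam *: (G a - G s).
Proof.
move=> aE sE; under eq_bigr do rewrite scalerDl scalerBl -!scalerA.
rewrite big_split sumrB -!scaler_sumr !sum_delta //=.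
by rewrite scalerBr opprB addrA addrAC.
Qed.

Lemma sum_weight_fw E c G w lam :
  w \in E ->
  \sum_(v <- E) ((1 - lam) * c v + lam * (v == w)%:R) *: G v =
  (1 - lam) *: (\sum_(v <- E) c v *: G v) + lam *: G w.
Proof.
move=> wE; under eq_bigr do rewrite scalerDl -!scalerA.
by rewrite big_split -!scaler_sumr sum_delta.
Qed.

End Weights.

Section Consistency.
Context {R : realType} {d : nat}.
Variable V : set 'rV[R]_d.
Implicit Types (X : bpcg_state R d).

(** Positivity is strict because the pyramidal width quantifies over supports
    with strictly positive weights. *)
Record consistent X : Prop := Consistent {
  active_sub : [set` active X] `<=` V;
  weight_gt0 : forall v, v \in active X -> 0 < weight X v;
  weight_out : forall v, v \notin active X -> weight X v = 0;
  weight_sum : \sum_(v <- active X) weight X v = 1;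
  weight_bary : \sum_(v <- active X) weight X v *: v = iterate X }.

Let sum1E (E : {fset 'rV[R]_d}) (c : 'rV[R]_d -> R) :
  \sum_(v <- E) c v = \sum_(v <- E) c v *: (1 : R^o).
Proof. by apply: eq_bigr => v _; rewrite /GRing.scale /= mulr1. Qed.

Lemma consistent_init x0 : V x0 -> consistent (bpcg_init x0).
Proof.
move=> Vx0; split=> /= [v|v|v||].
- by rewrite /= inE => /eqP ->.
- by rewrite inE => /eqP ->; rewrite eqxx ltr01.
- by rewrite inE => /negbTE ->.
- by rewrite sum1E sum_delta // inE.
- by rewrite (sum_delta id) // inE.
Qed.

(** If a = s the updated weight of a would still be weight X a, so dropping a
    would lose mass: hence the hypothesis a != s. *)
Lemma consistent_pairwise X a s lam :
  consistent X -> a \in active X -> s \in active X -> a != s ->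
  0 <= lam <= weight X a -> consistent (pairwise_update X a s lam).
Proof.
move=> [SV c0 cout c1 cb] aS sS as_ /andP[lam0 lamle].
have sub : (active (pairwise_update X a s lam) `<=` active X)%fset.
  by rewrite /=; case: ifP => _ //; rewrite fsubD1set.
have out v : v \in active X -> v \notin active (pairwise_update X a s lam) ->
    weight (pairwise_update X a s lam) v = 0.
  move=> vS; rewrite /=; case: ltP => [_|lamge]; first by rewrite vS.
  rewrite !inE vS andbT negbK => /eqP ->.
  rewrite eqxx (negbTE as_); have -> : lam = weight X a by apply/le_anti/andP.
  by rewrite mulr1 mulr0 subrr addr0.
split=> [v /(fsubsetP sub)/SV //|v|v||].
- move=> vS'; have vS := fsubsetP sub v vS'; move: vS' => /=.
  have [->|va] := eqVneq v a.
    rewrite (negbTE as_) mulr1 mulr0 addr0.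
    by case: ltP => [|_]; [rewrite subr_gt0|rewrite !inE eqxx].
  move=> _; rewrite mulr0 subr0; apply: ltr_wpDr; last exact: c0.
  by rewrite mulr_ge0.
- have [vS|vS _ /=] := boolP (v \in active X); first exact: out.
  rewrite cout // (_ : (v == a) = false) 1?(_ : (v == s) = false).
  + by rewrite !mulr0 subr0 addr0.
  + by apply: contraNF vS => /eqP ->.
  + by apply: contraNF vS => /eqP ->.
- rewrite sum1E (sum_weight_support _ sub out) /= sum_weight_pairwise //.
  by rewrite -sum1E c1 subrr scaler0 subr0.
- rewrite (sum_weight_support id sub out) /= (sum_weight_pairwise _ id) //.
  by rewrite cb.
Qed.

(** A zero step would put w in the active set with weight zero, hence the
    hypothesis 0 < lam. *)
Lemma consistent_fw X w lam :
  consistent X -> V w -> 0 < lam <= 1 -> consistent (fw_update X w lam).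
Proof.
move=> [SV c0 cout c1 cb] Vw /andP[lam0 lamle].
have w_in : w \in active (fw_update X w lam).
  by rewrite /=; case: ifP; rewrite !inE eqxx.
have sub : (active (fw_update X w lam) `<=` w |` active X)%fset.
  by rewrite /=; case: ifP => _ //; rewrite fsub1set !inE eqxx.
have out v : v \notin active (fw_update X w lam) ->
    weight (fw_update X w lam) v = 0.
  rewrite /=; case: eqVneq => [->|_]; rewrite !inE.
    by move=> /negbTE ->; rewrite subrr mul0r mulr0 addr0.
  by rewrite negb_or => /andP[/negbTE -> /cout ->]; rewrite !mulr0 addr0.
have out' v : v \in (w |` active X)%fset ->
    v \notin active (fw_update X w lam) -> weight (fw_update X w lam) v = 0.
  by move=> _; exact: out.
have supp v : v \in (w |` active X)%fset -> v \notin active X ->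
  weight X v = 0 by move=> _; exact: cout.
have subU : (active X `<=` w |` active X)%fset by exact: fsubsetU1.
have wU : w \in (w |` active X)%fset by rewrite !inE eqxx.
split=> [v /(fsubsetP sub)|v|v||].
- by rewrite !inE => /orP[/eqP -> //|]; exact: SV.
- move=> vS' /=; have [->|vw] := eqVneq v w.
    rewrite mulr1; apply: ltr_wpDl => //; apply: mulr_ge0.
      by rewrite subr_ge0.
    by have [/c0/ltW //|/cout ->] := boolP (w \in active X).
  move: vS' => /=; case: eqVneq => [->|lam1]; rewrite !inE (negbTE vw) //= => vS.
  by rewrite mulr0 addr0 mulr_gt0 ?c0 // subr_gt0 lt_neqAle lam1.
- exact: out.
- rewrite sum1E (sum_weight_support _ sub out') /= sum_weight_fw //.
  rewrite -(sum_weight_support _ subU supp) -sum1E c1.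
  by rewrite -scalerDl subrK scale1r.
- rewrite (sum_weight_support id sub out') /= (sum_weight_fw _ id) //.
  rewrite -(sum_weight_support id subU supp) /= cb scalerBl scale1r scalerBr.
  by rewrite opprB addrA addrAC.
Qed.

Lemma consistent_positive_support X :
  consistent X -> positive_supports V (iterate X) [set` active X].
Proof.
move=> [SV c0 _ c1 cb]; split=> //; exists (weight X); split=> //.
- by rewrite fsbig_finite // set_fsetK.
- by rewrite fsbig_finite // set_fsetK.
Qed.

End Consistency.

(** * One iteration *)

Section Step.
Context {R : realType} {d : nat}.
Implicit Types (P V : set 'rV[R]_d) (f : 'rV[R]_d -> R) (X Y : bpcg_state R d).

Lemma bpcg_step_le V f X Y :
  bpcg_step V f X Y -> f (iterate Y) <= f (iterate X).
Proof.
move=> [a [s [w [_ _ _]]]].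
case: ifP => _ [lam [/= /andP[lam0 lam1] lamle] ->] /=.
  by have := lamle 0; rewrite scale0r subr0 lexx (le_trans lam0 lam1); exact.
by have := lamle 0; rewrite scale0r subr0 lexx ler01; exact.
Qed.

Lemma consistent_dot_le V X u b :
  consistent V X -> (forall v, v \in active X -> dot u v <= b) ->
  dot u (iterate X) <= b.
Proof.
move=> [_ c0 _ c1 cb] ub; rewrite -cb dot_sumr -[b]mul1r -c1 mulr_suml.
rewrite big_seq [leRHS]big_seq; apply: ler_sum => v vS.
by rewrite dotZr ler_wpM2l ?ub // ltW ?c0.
Qed.

Lemma consistent_card_gt0 V X : consistent V X -> (0 < #|` active X|)%N.
Proof.
case=> _ _ _ c1 _; rewrite cardfs_gt0; apply/eqP => S0.
by move: c1; rewrite S0 big_seq_fset0 => /esym/eqP; rewrite oner_eq0.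
Qed.

(** In both kinds of steps 2 <g, d> >= <g, a - w>: the two candidate directions
    satisfy <g, a - s> + <g, x - w> >= <g, a - w> because <g, s> <= <g, x>, and
    the algorithm takes the one with the larger slope.  The assumption that the
    gap is positive excludes the degenerate steps: a = s would make x optimal,
    and the strict decrease in a Frank-Wolfe step forces a nonzero step size. *)
Lemma bpcg_step_progress P f mu L delta xstar X Y :
  let V := vertices P in
  let Q := L * diameter P ^+ 2 in
  let rate := Num.min (1 / 2) (mu * delta ^+ 2 / (4 * Q)) in
  let gap Z := f (iterate Z) - f xstar in
  polytope P -> (delta%:E <= pyramidal_width P)%E -> 0 < delta ->
  strongly_convex mu f -> smooth L f -> 0 < Q -> argmin P f xstar ->
  consistent V X -> P (iterate X) -> 0 < gap X ->
  bpcg_step V f X Y ->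
  consistent V Y /\
    ((gap Y <= (1 - rate) * gap X /\ (#|` active Y| <= #|` active X|.+1)%N) \/
     (gap Y <= gap X /\ #|` active X| = #|` active Y|.+1)).
Proof.
move=> V Q rate gap polyP width delta0 fconv fsmooth Q0 [Pstar _] consX Px h0.
move=> stepXY; have YX := bpcg_step_le stepXY; move: stepXY.
have mu0 := fconv.1.
have L0 : 0 < L.
  by move: Q0; rewrite /Q; have := sqr_ge0 (diameter P); nra.
set x := iterate X in Px YX *; set g := gradient f x.
have gapX : gap X = f x - f xstar by [].
move=> [a [s [w [[/= aS amax] [/= sS smin] [Vw wmin]]]]].
rewrite -/x -/g in amax smin wmin *.
have VP v : V v -> P v by exact: vertices_sub.
have SP v : v \in active X -> P v by move=> /(active_sub consX)/VP.
have wP y : P y -> dot g w <= dot g y.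
  move=> Py; have [v Vv vmin] := vertex_minimizes g polyP Py.
  exact: le_trans (wmin v Vv) (vmin y Py).
have xa : dot g x <= dot g a by exact: consistent_dot_le consX amax.
have sx : dot g s <= dot g x.
  rewrite -lerN2 -!dotNl; apply: consistent_dot_le consX _ => v vS.
  by rewrite !dotNl lerN2 smin.
have wx := wP x Px.
have hx : gap X <= dot g (x - w).
  have := strongly_convex_above_tangent x xstar fconv; rewrite -/g.
  have := wP xstar Pstar; rewrite gapX !dotE; lra.
have hG : 2 * mu * delta ^+ 2 * gap X <= dot g (a - w) ^+ 2.
  apply: (primal_gap_le fconv delta0); rewrite -/g.
  have := @pyramidal_width_scaling _ _ P [set` active X] delta (- dot g w)
    (- dot g a) (- g) x xstar polyP width (ltW delta0) Px Pstar
    (consistent_positive_support consX).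
  rewrite opprK (addrC _ (dot g a)) -dotBr.
  rewrite [dot (- g) (_ - _)]dotNl -[- dot g (_ - _)]dotNr opprB; apply.
    by move=> v /VP/wP; rewrite dotNl lerN2.
  by move=> v /amax; rewrite dotNl lerN2.
have hdd dd : dot g (a - w) <= 2 * dot g dd ->
    mu * delta ^+ 2 * gap X <= 2 * dot g dd ^+ 2.
  have : 0 <= dot g (a - w) by rewrite dotBr; lra.
  move: (dot g (a - w)) (dot g dd) hG => G e hG G0 Ge.
  have : G ^+ 2 <= (2 * e) ^+ 2 by rewrite lerXn2r // nnegrE // (le_trans G0).
  lra.
have smoothE dd t : enorm dd <= diameter P ->
    f (x - t *: dd) <= f x - t * dot g dd + Q / 2 * t ^+ 2.
  move=> /(smooth_step x t fsmooth (ltW L0)); rewrite -/g.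
  suff -> : L / 2 * t ^+ 2 * diameter P ^+ 2 = Q / 2 * t ^+ 2 by [].
  by rewrite /Q; ring.
have gapE F : F <= f x - rate * gap X -> F - f xstar <= (1 - rate) * gap X.
  by rewrite mulrBl mul1r gapX; lra.
case: ifP => [pw|/negbT fw].
- have Gas : dot g (a - w) <= 2 * dot g (a - s).
    by move: pw sx; rewrite !dotBr; lra.
  have asN : a != s.
    by apply: contraTneq pw => ->; rewrite subrr dot0r -ltNge (lt_le_trans h0).
  have asD : enorm (a - s) <= diameter P.
    by apply: le_diameter => //; exact: SP.
  case=> lam lammin YE; have [/= lam01 _] := lammin.
  rewrite YE; split; first exact: consistent_pairwise.
  rewrite /gap /= -/x; have [lamlt|lamge] := ltP lam (weight X a); last first.
    right; split; last by rewrite [LHS](cardfsD1 a) aS add1n.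
    by rewrite lerB //; rewrite YE in YX.
  left; split; last exact: leqnSn.
  apply/gapE/(@unbounded_search_progress _ Q _ (dot g (a - s))) => //.
  + by move: pw wx; rewrite !dotBr; lra.
  + by rewrite ltW.
  + exact: hdd.
  + move=> t t0; apply: le_trans (smoothE _ t asD).
    exact: segment_argmin_ray fconv lammin lamlt t0.
- case=> lam [[/= /andP[lam0 lam1] lammin]] YE.
  have Gxw : dot g (a - w) <= 2 * dot g (x - w).
    by move: fw sx; rewrite -ltNge !dotBr; lra.
  have xwD : enorm (x - w) <= diameter P by apply: le_diameter => //; exact: VP.
  have prog : f (x - lam *: (x - w)) <= f x - rate * gap X.
    apply: (@unit_search_progress _ Q _ (dot g (x - w))) => //.
    + by rewrite dotBr subr_ge0.
    + by rewrite ltW.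
    + exact: hdd.
    + by move=> t t01; apply: le_trans (smoothE _ t xwD); exact: lammin.
  have rate0 : 0 < rate.
    rewrite lt_min divr_gt0 //=.
    by apply: divr_gt0; apply: mulr_gt0 => //; exact: exprn_gt0.
  have lampos : 0 < lam.
    rewrite lt_neqAle lam0 andbT; apply: contraTneq prog => <-.
    by rewrite scale0r subr0 -ltNge gtrBl mulr_gt0.
  rewrite YE; split; first by apply: consistent_fw => //; rewrite lampos.
  left; split; first exact: gapE.
  rewrite /=; case: ifP => _; first by rewrite cardfs1.
  by rewrite cardfsU1; case: (_ \notin _); rewrite ?add1n ?add0n.
Qed.

End Step.

(** * Linear convergence *)

Theorem theorem3p2 (R : realType) (d : nat) (P : set 'rV[R]_d)
    (f : 'rV[R]_d -> R) (mu L delta D : R) (xstar : 'rV[R]_d)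
    (T : nat) (X : nat -> bpcg_state R d) :
  polytope P ->
  pyramidal_width P = delta%:E ->
  0 < delta ->
  D = diameter P ->
  (forall x : 'rV[R]_d, differentiable f x) ->
  strongly_convex mu f ->
  smooth L f ->
  argmin P f xstar ->
  bpcg_run P f T X ->
  (forall t : nat, (t <= T)%N -> P (iterate (X t))) ->
  f (iterate (X T)) - f xstar <=
    (f (iterate (X 0%N)) - f xstar) *
    expR (- (1 / 2 * Num.min (1 / 2) (mu * delta ^+ 2 / (4 * L * D ^+ 2)))
          * T%:R).
Proof.
move=> polyP width delta0 DE _ fconv fsmooth xmin [[x0 Vx0 X0E] run] PX.
pose h t := f (iterate (X t)) - f xstar; rewrite -!/(h _).
have h_ge0 t : (t <= T)%N -> 0 <= h t.
  by move=> tT; rewrite subr_ge0; apply: xmin.2; exact: PX.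
have h_dec t : (t < T)%N -> h t.+1 <= h t.
  by move=> /run/bpcg_step_le; rewrite /h lerD2r.
rewrite -(mulrA 4 L) DE; set Q := L * _; set rate := Num.min _ _.
(* If L D^2 <= 0, division by zero or the sign makes rate <= 0, and the claim
   follows from monotonicity. *)
have [Qle0|Q0] := leP Q 0.
  have h_le t : (t <= T)%N -> h t <= h 0%N.
    by elim: t => // t IHt tT; apply: le_trans (h_dec _ tT) (IHt (ltnW tT)).
  apply: le_trans (h_le T (leqnn T)) _; rewrite ler_peMr ?h_ge0 //.
  rewrite -[X in X <= _]expR0 ler_expR mulr_ge0 // oppr_ge0.
  apply: mulr_ge0_le0; first by rewrite divr_ge0.
  rewrite ge_min; apply/orP; right; apply: mulr_ge0_le0.
    by apply: mulr_ge0; [exact: ltW fconv.1|exact: sqr_ge0].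
  by rewrite invr_le0; apply: mulr_ge0_le0.
have rate0 : 0 <= rate.
  rewrite le_min divr_ge0 //=; apply: divr_ge0; apply: mulr_ge0 => //.
  - exact: ltW fconv.1.
  - exact: sqr_ge0.
  - exact: ltW.
pose k t := (t + #|` active (X t)|)%N.
have inv t : (t <= T)%N -> h t = 0 \/
    consistent (vertices P) (X t) /\
    h t <= h 0%N * expR (- (1 / 2 * rate) * (k t)%:R + 1 / 2 * rate).
  elim: t => [_|t IHt tT].
    right; rewrite /k X0E; split; first exact: consistent_init.
    by rewrite /= add0n cardfs1 mulr1 addNr expR0 mulr1.
  have := h_ge0 t (ltnW tT); rewrite le_eqVlt => /orP[/eqP ht0|ht0].
    by left; apply: le_anti; rewrite h_ge0 // andbT ht0 h_dec.
  have [htE|[consX htle]] := IHt (ltnW tT).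
    by move: ht0; rewrite htE ltxx.
  have widthP : (delta%:E <= pyramidal_width P)%E by rewrite width.
  have [consY [[hY cardY]|[hY cardY]]] := bpcg_step_progress polyP widthP delta0
    fconv fsmooth Q0 xmin consX (PX t (ltnW tT)) ht0 (run t tT).
  - right; split=> //; apply: le_trans hY _.
    apply: (@le_trans _ _ (expR (- rate) * h t)).
      rewrite ler_wpM2r ?h_ge0 ?(ltnW tT) //; exact: expR_ge1Dx.
    rewrite mulrC; apply: (@le_trans _ _ (h 0%N *
      expR (- (1 / 2 * rate) * (k t)%:R + 1 / 2 * rate) * expR (- rate))).
      by rewrite ler_wpM2r ?expR_ge0.
    rewrite -mulrA -expRD ler_wpM2l ?h_ge0 // ler_expR.
    have kk : (k t.+1)%:R <= (k t)%:R + 2 :> R.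
      by rewrite -(natrD _ _ 2) ler_nat /k addSn addn2 ltnS -addnS leq_add2l.
    have := ler_wpM2l rate0 kk; lra.
  - right; split=> //; apply: le_trans hY _.
    by rewrite (_ : k t.+1 = k t) // /k cardY addSnnS.
have [->|[consT /le_trans]] := inv T (leqnn T).
  by rewrite mulr_ge0 ?expR_ge0 ?h_ge0.
apply; rewrite ler_wpM2l ?h_ge0 // ler_expR.
have kT : T%:R + 1 <= (k T)%:R :> R.
  by rewrite natr1 ler_nat /k -addn1 leq_add2l (consistent_card_gt0 consT).
have := ler_wpM2l rate0 kT; lra.
Qed.
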